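(* Let $T>0$, $0<\theta<1$ and $Y_\theta:=(\mathcal D(C),\mathcal D(C^2))_{\theta,1}$. For $0<h\le h_0$ and $t_k=kh\in[0,T]$ put $R_k:=R_h(t_k)$, $P_k:=P_h(t_k)$, $E_h(t):=R_h(t)-P_h(t)$, and define the time-ordered products $\mathcal R_{j:k}:=R_jR_{j-1}\cdots R_k$ and $\mathcal P_{j:k}:=P_jP_{j-1}\cdots P_k$ for $j\ge k$, and $\mathcal R_{j:k}=\mathcal P_{j:k}=I$ for $j<k$. Assume that the frozen steps $R_h(t),P_h(t)\in\mathcal L(\mathcal E_p)$ are well defined for all $t\in[0,T]$, $0<h\le h_0$, and that there are constants $q<1$ and $K,M_T,M_{T,\theta}>0$, independent of $h\in(0,h_0]$, such that for all $0<h\le h_0$: (B1) $\sup_{t\in[0,T]}\sup_{0<h\le h_0}\|H_h(t)\|_{\mathcal L(\mathcal E_p)}\le q<1$; (B2) $\sup_{t\in[0,T]}\|E_h(t)\|_{\mathcal L(Y_\theta,\mathcal E_p)}\le K h^{1+\theta}$; (B3) $\sup_{0\le k\le j,\ jh\le T}\|\mathcal R_{j:k}\|_{\mathcal L(\mathcal E_p)}\le M_T$; (B4) $\sup_{0\le kh\le T}\|\mathcal P_{k-1:0}\|_{\mathcal L(Y_\theta)}\le M_{T,\theta}$ (in particular these products map $Y_\theta$ into $Y_\theta$). Then there exists $K_{T,\theta}>0$ such that for all $0<h\le h_0$ and all $n$ with $nh\le T$, $$\|\mathcal R_{n-1:0}-\mathcal P_{n-1:0}\|_{\mathcal L(Y_\theta,\mathcal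 E_p)}\le K_{T,\theta}h^\theta .$$
   Context: Let $X$ be a Banach space, $\tau<0$, $1<p<\infty$, and $\mathcal E_p:=X\oplus L^p([\tau,0];X)$ with norm $\|(u,\rho)\|_{\mathcal E_p}=\|u\|_X+\|\rho\|_{L^p}$. The transport operator is $C(u,\rho):=(0,\partial_\sigma\rho)$ with domain $\mathcal D(C):=\{(u,\rho)\in X\oplus W^{1,p}([\tau,0];X):\rho(0)=u\}$; its resolvent $S_h^C:=(I-hC)^{-1}\in\mathcal L(\mathcal E_p)$ exists for every $h>0$. $\mathcal D(C)$ carries the graph norm $\|x\|_{\mathcal E_p}+\|Cx\|_{\mathcal E_p}$, and $\mathcal D(C^2)=\{x\in\mathcal D(C):Cx\in\mathcal D(C)\}$ carries the norm $\|x\|_{\mathcal E_p}+\|Cx\|_{\mathcal E_p}+\|C^2x\|_{\mathcal E_p}$. $(\cdot,\cdot)_{\theta,1}$ denotes real interpolation. For $t\in[0,T]$ let $D(t):\mathcal D(C)\to\mathcal E_p$ be linear. Fix $h_0>0$. Set $H_h(t):=hD(t)S_h^C$, $R_h(t):=(I-h(C+D(t)))^{-1}$ (with $\mathcal D(C+D(t))=\mathcal D(C)$) and $P_h(t):=(I-H_h(t))^{-1}S_h^C$. *)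

(* Defs.v *)
From HB Require Import structures.
From mathcomp Require Import all_boot all_order all_algebra.
From mathcomp Require Import all_classical all_reals all_analysis.
From mathcomp Require Import measurable_realfun.

Set Implicit Arguments.
Unset Strict Implicit.
Unset Printing Implicit Defensive.

Import Order.TTheory GRing.Theory Num.Theory.
Import numFieldNormedType.Exports.

Local Open Scope classical_set_scope.
Local Open Scope ring_scope.

Section bochner.
Context {d : measure_display} {T : measurableType d} {R : realType}.
Context {X : normedModType R}.
Variable mu : {measure set T -> \bar R}.
Implicit Types f g s : T -> X.

Definition simple s : Prop :=
  finite_set (range s) /\ forall x, measurable (s @^-1` [set x]).

(* The limit is required everywhere, not only almost everywhere: up to
   equality almost everywhere both conventions give the same functions. *)
Definition strongly_measurable f : Prop :=
  exists2 s : nat -> T -> X, (forall n, simple (s n)) &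
    forall t, s n t @[n --> \oo] --> f t.

Definition simple_integral s : X :=
  \sum_(x \in range s) fine (mu (s @^-1` [set x])) *: x.

Definition is_bochner_integral f (a : X) : Prop :=
  strongly_measurable f /\
  exists s : nat -> T -> X,
    [/\ forall n, simple (s n),
        forall n x, x != 0 -> (mu (s n @^-1` [set x]) < +oo)%E,
        (\int[mu]_t (`|f t - s n t|)%:E)%E @[n --> \oo] --> 0%E &
        simple_integral (s n) @[n --> \oo] --> a].

Definition bochner_integral f : X := xget 0 [set a | is_bochner_integral f a].

Lemma simple_preimage s (A : set X) : simple s -> measurable (s @^-1` A).
Proof.
move=> [sfin smeas].
have -> : s @^-1` A = \bigcup_(x in range s `&` A) (s @^-1` [set x]).
  apply/seteqP; split => [t At|t [x [_ Ax] /= stx]] /=; last by rewrite stx.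
  by exists (s t) => //; split => //; exists t.
apply: fin_bigcup_measurable => //.
exact: finite_setIl.
Qed.

Lemma simpleP (a : R) f g : simple f -> simple g -> simple (a *: f + g).
Proof.
move=> sf sg; split.
  have := finite_image2 (fun x y => a *: x + y) sf.1 sg.1.
  apply: sub_finite_set => _ [t _ <-] /=.
  exists (f t); first by exists t.
  by exists (g t) => //; exists t.
move=> x.
have -> : (a *: f + g) @^-1` [set x] =
  \bigcup_(y in range f) (f @^-1` [set y] `&` g @^-1` [set x - a *: y]).
  apply/seteqP; split => [t /= <-|t [y _ [/= <- gt]]].
    exists (f t); first by exists t.
    split => //=; change (g t = a *: f t + g t - a *: f t).
    by rewrite addrAC subrr add0r.
  by change (a *: f t + g t = x); rewrite gt addrC subrK.
apply: fin_bigcup_measurable; first exact: sf.1.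
by move=> y _; apply: measurableI; apply: simple_preimage.
Qed.

Lemma simple0 : simple (0 : T -> X).
Proof.
split; first by apply: (sub_finite_set _ (finite_set1 (0 : X))) => _ [t _ <-].
move=> x; have [->|x0] := eqVneq x 0.
  rewrite (_ : _ @^-1` _ = setT)//; exact/seteqP.
rewrite (_ : _ @^-1` _ = set0)//; apply/seteqP; split => // t /= h.
by move: x0; rewrite -h eqxx.
Qed.

Lemma strongly_measurableP (a : R) f g :
  strongly_measurable f -> strongly_measurable g ->
  strongly_measurable (a *: f + g).
Proof.
move=> [s ss sf] [u su ug]; exists (fun n => a *: s n + u n).
  by move=> n; exact: simpleP.
by move=> t; apply: cvgD; [apply: cvgZr; exact: sf|exact: ug].
Qed.

Lemma strongly_measurable0 : strongly_measurable (0 : T -> X).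
Proof.
by exists (fun=> 0) => [n|t]; [exact: simple0|exact: cvg_cst].
Qed.

Lemma measurable_normX f : strongly_measurable f ->
  measurable_fun [set: T] (fun t => `|f t|).
Proof.
move=> [s ss sf].
apply: (@measurable_fun_cvg _ _ _ _ (fun n t => `|s n t|)).
  move=> n _ B mB; rewrite setTI.
  rewrite (_ : _ @^-1` B = s n @^-1` [set x | B `|x|])//.
  exact: simple_preimage.
by move=> t _; apply: cvg_norm; exact: sf.
Qed.

End bochner.


Section lebesgue_bochner.
Context {d : measure_display} {T : measurableType d} {R : realType}.
Variables (mu : {measure set T -> \bar R}) (X : normedModType R).
Variables (p : R) (p1 : 1 <= p).
Local Notation N f := ('N[mu]_(p%:E)[EFin \o (fun t => `|f t|%R)])%E.

(* The unused proof argument keeps p1 in the type, as in LfunType. *)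
Definition Lpfun_pred of 1 <= p : {pred T -> X} :=
  mem [set f : T -> X | strongly_measurable f /\ (N f < +oo)%E].

Let p_gt0 : 0 < p. Proof. exact: lt_le_trans p1. Qed.

Let measurable_pow (h : T -> R) : measurable_fun setT h ->
  measurable_fun setT (fun t => (`|(EFin \o h) t| `^ p)%E).
Proof.
move=> mh; apply: (measurableT_comp (measurable_poweR _)).
by apply/measurable_EFinP; exact: measurableT_comp.
Qed.

Lemma LnormX_le (f : T -> X) (h : T -> R) :
  strongly_measurable f -> measurable_fun setT h ->
  (forall t, `|f t| <= h t) -> (N f <= 'N[mu]_(p%:E)[EFin \o h])%E.
Proof.
move=> mf mh fh; rewrite unlock /Lnorm.
apply: gt0_ler_poweR; first by rewrite invr_ge0 ltW.
- by rewrite in_itv/= leey andbT integral_ge0// => t _; rewrite poweR_ge0.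
- by rewrite in_itv/= leey andbT integral_ge0// => t _; rewrite poweR_ge0.
apply: ge0_le_integral => //.
- by move=> t _; rewrite poweR_ge0.
- by apply: measurable_pow; exact: measurable_normX.
- exact: measurable_pow.
move=> t _; apply: gt0_ler_poweR; rewrite ?in_itv/= ?leey ?andbT ?abse_ge0 ?(ltW p_gt0)//.
by rewrite lee_fin normr_id (le_trans (fh t))// ler_norm.
Qed.

Lemma LnormXD (f g : T -> X) :
  strongly_measurable f -> strongly_measurable g ->
  (N (f \+ g)%R <= N f + N g)%E.
Proof.
move=> mf mg.
have mfg : strongly_measurable (f \+ g)%R.
  by have := strongly_measurableP 1 mf mg; rewrite scale1r.
have mf' := measurable_normX mf; have mg' := measurable_normX mg.
apply: le_trans (minkowski_EFin mu mf' mg' p1).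
apply: LnormX_le => //; first exact: measurable_funD.
by move=> t; exact: ler_normD.
Qed.

Lemma LnormXZ (a : R) (f : T -> X) : strongly_measurable f ->
  (N (a *: f) = `|a|%:E * N f)%E.
Proof.
move=> mf; rewrite unlock /Lnorm.
rewrite (_ : integral _ _ _ = \int[mu]_t ((`|a| `^ p)%:E *
    `|(EFin \o (fun t => `|f t|%R)) t| `^ p))%E; last first.
  by apply: eq_integral => t _; rewrite -poweR_EFin -poweRM//= !normr_id normrZ.
rewrite ge0_integralZl//=; first last.
  by apply: measurable_pow; exact: measurable_normX.
rewrite poweRM ?lee_fin ?powR_ge0 ?integral_ge0//.
by rewrite poweR_EFin -powRrM mulfV ?gt_eqF// powRr1.
Qed.

Lemma LnormX_eq0 (f : T -> X) : strongly_measurable f ->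
  (N f = 0)%E -> {ae mu, forall t, f t = 0}.
Proof.
move=> mf Nf0.
have mNf : measurable_fun setT (EFin \o (fun t => `|f t|)).
  by apply/measurable_EFinP; exact: measurable_normX.
have := Lnorm_eq0_eq0 mNf _ Nf0; rewrite lte_fin p_gt0 => /(_ isT).
apply: filterS => t /(_ I) [] /eqP.
by rewrite normr_eq0 => /eqP.
Qed.

Lemma Lnorm_ae_eqX (f g : T -> X) :
  strongly_measurable f -> strongly_measurable g ->
  {ae mu, forall t, f t = g t} -> N f = N g.
Proof.
move=> mf mg fg; rewrite unlock /Lnorm; congr (_ `^ _)%E.
apply: ge0_ae_eq_integral => //.
- by apply: measurable_pow; exact: measurable_normX.
- by apply: measurable_pow; exact: measurable_normX.
- by move=> t _; rewrite poweR_ge0.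
- by move=> t _; rewrite poweR_ge0.
by apply: filterS fg => t fgt _; rewrite /= fgt.
Qed.

Lemma Lpfun_submod_closed : submod_closed (Lpfun_pred p1).
Proof.
split=> [|a f g]; rewrite !inE/=.
  split; first exact: strongly_measurable0.
  have -> : N (0 : T -> X) = 'N[mu]_(p%:E)[cst 0]%E.
    by apply: eq_Lnorm => t /=; rewrite normr0.
  by rewrite Lnorm0// eqe gt_eqF.
move=> [mf Nf] [mg Ng]; split; first exact: strongly_measurableP.
have maf : strongly_measurable (a *: f).
  by have := strongly_measurableP a mf strongly_measurable0; rewrite addr0.
apply: le_lt_trans (LnormXD maf mg) _.
by rewrite lte_add_pinfty// LnormXZ// lte_mul_pinfty// lee_fin.
Qed.

HB.instance Definition _ :=
  GRing.isSubmodClosed.Build R (T -> X) (Lpfun_pred p1) Lpfun_submod_closed.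

Record Lpfun := MkLpfun {
  Lpfun_val :> T -> X ; _ : Lpfun_val \in Lpfun_pred p1 }.
HB.instance Definition _ := [isSub for Lpfun_val].
HB.instance Definition _ := gen_eqMixin Lpfun.
HB.instance Definition _ := gen_choiceMixin Lpfun.
HB.instance Definition _ := [SubChoice_isSubLmodule of Lpfun by <:].


Lemma Lpfun_meas (f : Lpfun) : strongly_measurable f.
Proof. by have := valP f; rewrite inE => -[]. Qed.

Lemma Lpfun_fin (f : Lpfun) : N f \is a fin_num.
Proof.
rewrite fin_numE gt_eqF ?(lt_le_trans _ (Lnorm_ge0 _ _ _))// lt_eqF//.
by have := valP f; rewrite inE => -[].
Qed.

Definition Lpnull : {pred Lpfun} :=
  mem [set f : Lpfun | {ae mu, forall t, f t = 0}].

Lemma Lpnull_zmod_closed : zmod_closed Lpnull.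
Proof.
split=> [|f g]; rewrite !inE/=.
  exact/aeW.
apply: filterS2 => t f0 g0.
by change (f t - g t = 0); rewrite f0 g0 subr0.
Qed.

HB.instance Definition _ :=
  GRing.isZmodClosed.Build Lpfun Lpnull Lpnull_zmod_closed.

Definition Lp : Type := Quotient.quot Lpnull.
HB.instance Definition _ := GRing.Zmodule.on Lp.
HB.instance Definition _ := EqQuotient.on Lp.

Local Notation pi := (\pi_(Lp)%qT).

Let pi_eqP (f g : Lpfun) :
  pi f = pi g <-> {ae mu, forall t, f t = g t}.
Proof.
have -> : (pi f = pi g) <-> (f - g \in Lpnull).
  by rewrite Quotient.idealrBE; split => /eqP.
rewrite inE/=; split; apply: filterS => t.
  by move=> /eqP; rewrite [(_ - _) t]/(f t - g t) subr_eq0 => /eqP.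
by move=> fg; change (f t - g t = 0); rewrite fg subrr.
Qed.

Let piD (f g : Lpfun) : pi (f + g) = pi f + pi g.
Proof. exact: Quotient.pi_add. Qed.

Let piN (f : Lpfun) : pi (- f) = - pi f.
Proof. exact: Quotient.pi_opp. Qed.

Let pi0 : pi 0 = 0.
Proof. by rewrite -[0](subrr 0) piD piN subrr. Qed.

Definition Lpscale (a : R) (x : Lp) : Lp := pi (a *: (repr x : Lpfun)).

Let piZ a (f : Lpfun) : Lpscale a (pi f) = pi (a *: f).
Proof.
apply/pi_eqP; have /pi_eqP : pi (repr (pi f)) = pi f by exact: reprK.
by apply: filterS => t e; change (a *: repr (pi f) t = a *: f t); rewrite e.
Qed.

Fact LpscaleA a b x : Lpscale a (Lpscale b x) = Lpscale (a * b) x.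
Proof. by rewrite -[x]reprK (piZ b) (piZ a) piZ scalerA. Qed.

Fact Lpscale1 : left_id 1 Lpscale.
Proof. by move=> x; rewrite -[x]reprK piZ scale1r. Qed.

Fact LpscaleDr : right_distributive Lpscale +%R.
Proof.
by move=> a x y; rewrite -[x]reprK -[y]reprK -piD !piZ -piD scalerDr.
Qed.

Fact LpscaleDl x : {morph Lpscale^~ x : a b / a + b}.
Proof. by move=> a b; rewrite -[x]reprK !piZ -piD scalerDl. Qed.

HB.instance Definition _ := GRing.Zmodule_isLmodule.Build R Lp
  LpscaleA Lpscale1 LpscaleDr LpscaleDl.

Definition Lp_fun (x : Lp) : T -> X := (repr x : Lpfun).

Definition Lpnorm (x : Lp) : R := fine (N (Lp_fun x)).

Let Lpnorm_pi (f : Lpfun) : (Lpnorm (pi f))%:E = N f.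
Proof.
rewrite /Lpnorm fineK ?Lpfun_fin//.
apply: Lnorm_ae_eqX; [exact: Lpfun_meas|exact: Lpfun_meas|].
by apply/pi_eqP; exact: reprK.
Qed.

Fact ler_LpnormD x y : Lpnorm (x + y) <= Lpnorm x + Lpnorm y.
Proof.
rewrite -[x]reprK -[y]reprK -piD -lee_fin EFinD !Lpnorm_pi.
by apply: LnormXD; exact: Lpfun_meas.
Qed.

Fact LpnormZ a x : Lpnorm (a *: x) = `|a| * Lpnorm x.
Proof.
apply: EFin_inj; rewrite -[x]reprK [_ *: _]piZ EFinM !Lpnorm_pi.
by rewrite -LnormXZ//; exact: Lpfun_meas.
Qed.

Fact Lpnorm_eq0 x : Lpnorm x = 0 -> x = 0.
Proof.
move=> x0; have Nf0 : N (repr x : Lpfun) = 0%E.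
  by rewrite -Lpnorm_pi reprK x0.
rewrite -[x]reprK -pi0; apply/pi_eqP.
exact: LnormX_eq0 (Lpfun_meas _) Nf0.
Qed.

Fact LpnormN x : Lpnorm (- x) = Lpnorm x.
Proof. by rewrite -scaleN1r LpnormZ normrN1 mul1r. Qed.

Fact LpnormMn x n : Lpnorm (x *+ n) = Lpnorm x *+ n.
Proof. by rewrite -scaler_nat LpnormZ normr_nat mulr_natl. Qed.

HB.instance Definition _ := Num.Zmodule_isNormed.Build R Lp
  ler_LpnormD Lpnorm_eq0 LpnormMn LpnormN.

End lebesgue_bochner.
Coercion Lp_fun : Lp >-> Funclass.

Section operators.
Context {R : realType} {V : lmodType R}.
Implicit Types (A B : V -> V) (x y : V).

(* The values of nsnorm outside carrier are irrelevant. *)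
Record normed_subspace := NormedSubspace {
  carrier : set V;
  nsnorm : V -> R }.
Implicit Types U W : normed_subspace.

Definition linear_on (U : set V) A : Prop :=
  forall (a : R) x y, U x -> U y -> A (a *: x + y) = a *: A x + A y.

(* The operator norm in L(U, W): it is +oo when A does not map U into W. *)
Definition opnorm U W A : \bar R :=
  ereal_inf [set M%:E | M in [set M : R | 0 <= M /\
    forall x, carrier U x -> carrier W (A x) /\ nsnorm W (A x) <= M * nsnorm U x]].

Definition bounded_linear U W A : Prop :=
  linear_on (carrier U) A /\ (opnorm U W A < +oo)%E.

(* The inverse of B : U -> V, with junk value 0 outside the range of B. *)
Definition inverse_on (U : set V) B : V -> V :=
  fun y => xget 0 [set x | U x /\ B x = y].

Definition Kfunctional U W (t : R) x : \bar R :=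
  ereal_inf [set k | exists a b, [/\ carrier U a, carrier W b, x = a + b &
    k = (nsnorm U a + t * nsnorm W b)%:E]].

Definition interp1_norm (theta : R) U W x : \bar R :=
  (\int[lebesgue_measure]_(t in `]0%R, +oo[)
    ((t `^ (- theta))%:E * Kfunctional U W t x * (t^-1)%:E))%E.

(* The real interpolation space (U, W)_(theta, 1), by the K-method. *)
Definition interp1 (theta : R) U W : normed_subspace :=
  NormedSubspace
    [set x | (exists a b, [/\ carrier U a, carrier W b & x = a + b]) /\
             (interp1_norm theta U W x < +oo)%E]
    (fun x => fine (interp1_norm theta U W x)).

(* A (m - 1) o ... o A k, and the identity if m <= k; the product written
   A_(j:k) is ordered_prod A k j.+1. *)
Fixpoint ordered_prod (A : nat -> V -> V) (k m : nat) : V -> V :=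
  if m is m'.+1 then
    if (k <= m')%N then A m' \o ordered_prod A k m' else id
  else id.

End operators.
Arguments normed_subspace {R} V.

Section sobolev.
Context {R : realType} (X : normedModType R) (tau p : R) (p1 : 1 < p).

Definition lebesgue_delay : {measure set (measurableTypeR R) -> \bar R} :=
  mrestr lebesgue_measure (measurable_itv `[tau, 0]).

Local Notation Lp_delay := (Lp lebesgue_delay X (ltW p1)).
Implicit Types rho g : Lp_delay.

Definition test_function (a b : R) (phi : R -> R) : Prop :=
  (forall n x, derivable (phi^`(n))%classic x 1) /\
  exists c e, [/\ a < c, e < b & forall x, phi x != 0 -> c <= x <= e].

Definition is_weak_derivative rho g : Prop :=
  forall phi, test_function tau 0 phi ->
    bochner_integral lebesgue_delay (fun s => (phi^`())%classic s *: rho s) =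
    - bochner_integral lebesgue_delay (fun s => phi s *: g s).

Definition W1p : set Lp_delay := [set rho | exists g, is_weak_derivative rho g].

Definition weak_derivative rho : Lp_delay :=
  xget 0 [set g | is_weak_derivative rho g].

(* rho(0) = u, where rho(0) is read on the continuous representative. *)
Definition has_trace0 rho (u : X) : Prop :=
  exists r : R -> X, [/\ {within `[tau, 0], continuous r},
    {ae lebesgue_delay, forall s, rho s = r s} & r 0 = u].

End sobolev.

Section transport.
Context {R : realType} (X : normedModType R) (tau p : R) (p1 : 1 < p).

Definition Ep_type : lmodType R := (X * Lp (lebesgue_delay tau) X (ltW p1))%type.
Implicit Types x : Ep_type.

Definition Ep_norm x : R := `|x.1| + `|x.2|.

Definition Ep : normed_subspace Ep_type := NormedSubspace setT Ep_norm.

Definition transport x : Ep_type := (0, weak_derivative x.2).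

Definition domC : normed_subspace Ep_type :=
  NormedSubspace [set x | W1p x.2 /\ has_trace0 x.2 x.1]
    (fun x => Ep_norm x + Ep_norm (transport x)).

Definition domC2 : normed_subspace Ep_type :=
  NormedSubspace [set x | carrier domC x /\ carrier domC (transport x)]
    (fun x => Ep_norm x + Ep_norm (transport x) +
              Ep_norm (transport (transport x))).

Definition Ytheta (theta : R) : normed_subspace Ep_type :=
  interp1 theta domC domC2.

Definition resolventC (h : R) : Ep_type -> Ep_type :=
  inverse_on (carrier domC) (fun x => x - h *: transport x).

Variable D : R -> Ep_type -> Ep_type.

Definition Hstep (h t : R) x : Ep_type := h *: D t (resolventC h x).

Definition Rstep (h t : R) : Ep_type -> Ep_type :=
  inverse_on (carrier domC) (fun x => x - h *: (transport x + D t x)).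

Definition Pstep (h t : R) x : Ep_type :=
  inverse_on setT (fun y => y - Hstep h t y) (resolventC h x).

Definition frozen_steps_well_defined (h t : R) : Prop :=
  [/\ set_bij (carrier domC) setT (fun x => x - h *: (transport x + D t x)),
      bounded_linear Ep Ep (Rstep h t),
      set_bij setT setT (fun y => y - Hstep h t y) &
      bounded_linear Ep Ep (Pstep h t)].

Definition Estep (h t : R) x : Ep_type := Rstep h t x - Pstep h t x.

Definition Rprod (h : R) : nat -> nat -> Ep_type -> Ep_type :=
  ordered_prod (fun k => Rstep h (k%:R * h)).

Definition Pprod (h : R) : nat -> nat -> Ep_type -> Ep_type :=
  ordered_prod (fun k => Pstep h (k%:R * h)).

End transport.
Arguments Ep_type {R} X tau {p} p1.
Arguments Ep {R} X tau {p} p1.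
Arguments domC {R} X tau {p} p1.
Arguments domC2 {R} X tau {p} p1.
Arguments Ytheta {R} X tau {p} p1 theta.

(* Main.v *)
(* Telescoping: R_(n-1:0) - P_(n-1:0) is the sum over k < n of
   R_(n-1:k+1) E_h(t_k) P_(k-1:0).  By (B4), (B2) and (B3) each of the n terms
   has norm O(h ^ (1 + theta)) from Y_theta to E_p, and n h <= T. *)
Require Import Defs.
From HB Require Import structures.
From mathcomp Require Import all_boot all_order all_algebra.
From mathcomp Require Import all_classical all_reals all_analysis.
From mathcomp Require Import ring.

Set Implicit Arguments.
Unset Strict Implicit.
Unset Printing Implicit Defensive.

Import Order.TTheory GRing.Theory Num.Theory.
Import numFieldNormedType.Exports.

Local Open Scope classical_set_scope.
Local Open Scope ring_scope.

Section ordered_products.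
Context {R : realType} {V : lmodType R}.
Implicit Types (A B : nat -> V -> V) (U W : normed_subspace V).

Lemma ordered_prodS A k m x : (k <= m)%N ->
  ordered_prod A k m.+1 x = A m (ordered_prod A k m x).
Proof. by move=> km; rewrite /= km. Qed.

Lemma ordered_prodnn A k x : ordered_prod A k k x = x.
Proof. by case: k => //= k; rewrite ltnn. Qed.

Lemma linear_on_sum (f : V -> V) (F : nat -> V) n : linear_on setT f ->
  f (\sum_(k < n) F k) = \sum_(k < n) f (F k).
Proof.
move=> flin; have fD x y : f (x + y) = f x + f y.
  by have := flin 1 x y I I; rewrite !scale1r.
apply: (big_morph f fD); apply: (addrI (f 0)).
by rewrite -fD !addr0.
Qed.

(** Induction on [n]: if [a] and [b] are the two products of length [n] applied to [x], then [A n a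
    - B n b = A n (a - b) + (A n b - B n b)], and linearity carries [A n] through the sum that
    expresses [a - b]. *)
Lemma ordered_prod_telescope A B n x :
  (forall k, (k < n)%N -> linear_on setT (A k)) ->
  ordered_prod A 0 n x - ordered_prod B 0 n x =
  \sum_(k < n) ordered_prod A k.+1 n
    (A k (ordered_prod B 0 k x) - B k (ordered_prod B 0 k x)).
Proof.
elim: n => [|n IHn] Alin; first by rewrite big_ord0 subrr.
have An := Alin n (ltnSn n).
have AnB y z : A n (y - z) = A n y - A n z.
  by have := An (-1) z y I I; rewrite !scaleN1r ![- _ + _]addrC.
pose F k := ordered_prod A k.+1 n
  (A k (ordered_prod B 0 k x) - B k (ordered_prod B 0 k x)).
(* The new summand, [k = n], has an empty product in front; each earlier one gains the outer factor
   [A n]. *)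
rewrite big_ord_recr ordered_prodnn !ordered_prodS//.
rewrite (eq_bigr (fun k : 'I_n => A n (F k))); last first.
  by move=> k _; rewrite ordered_prodS//; exact: (ltn_ord k).
rewrite -(linear_on_sum F _ An) -IHn; last by move=> k /ltnW; exact: Alin.
by rewrite AnB /= addrA subrK.
Qed.

Lemma opnorm_le U W (f : V -> V) (M : R) : 0 <= M ->
  (forall x, carrier U x ->
    carrier W (f x) /\ nsnorm W (f x) <= M * nsnorm U x) ->
  (opnorm U W f <= M%:E)%E.
Proof. by move=> M0 fM; apply: ereal_inf_lbound; exists M. Qed.

(** An infimum only yields admissible constants below [M + e] for each [e > 0], so the bound by [M]
    itself comes from letting [e] tend to 0. Nonnegativity of [nsnorm U x] is a hypothesis because
    the record [normed_subspace] does not impose it. *)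
Lemma opnorm_le_bound U W (f : V -> V) (M : R) x :
  (opnorm U W f <= M%:E)%E -> carrier U x -> 0 <= nsnorm U x ->
  carrier W (f x) /\ nsnorm W (f x) <= M * nsnorm U x.
Proof.
move=> fM Ux x0.
have near_inf e : 0 < e -> carrier W (f x) /\
    nsnorm W (f x) <= (M + e) * nsnorm U x.
  move=> e0; have : (opnorm U W f < (M + e)%:E)%E.
    by rewrite (le_lt_trans fM)// lte_fin ltrDl.
  move=> /ereal_inf_lt[_ [M' [_ /(_ _ Ux)[Wfx fx]] <-]].
  rewrite lte_fin => /ltW M'e; split => //.
  by rewrite (le_trans fx)// ler_wpM2r.
split; first exact: (near_inf 1 ltr01).1.
apply/ler_addgt0Pr => e e0.
(* The slack [e / (nsnorm U x + 1)] adds at most [e] to the bound; the 1 keeps the divisor positive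
   when [nsnorm U x] is 0. *)
have x1 : 0 < nsnorm U x + 1 by rewrite ltr_wpDl.
have [_ /le_trans->//] := near_inf _ (divr_gt0 e0 x1).
rewrite mulrDl lerD2l mulrAC ler_pdivrMr// ler_wpM2l ?(ltW e0)//.
by rewrite lerDl.
Qed.

Lemma interp1_norm_ge0 theta U W x :
  (forall y, 0 <= nsnorm U y) -> (forall y, 0 <= nsnorm W y) ->
  (0 <= interp1_norm theta U W x)%E.
Proof.
move=> U0 W0; apply: integral_ge0 => t /=; rewrite in_itv/= andbT => t0.
rewrite !mule_ge0 ?lee_fin ?powR_ge0 ?invr_ge0 ?(ltW t0)//.
apply: le_ereal_inf_tmp => _ [a [b [_ _ _ ->]]].
by rewrite lee_fin addr_ge0// mulr_ge0// ltW.
Qed.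

End ordered_products.

Section delay_space.
Context {R : realType} (X : normedModType R) (tau p : R) (p1 : 1 < p).
Implicit Types x y : Ep_type X tau p1.

Lemma Ep_norm_ge0 x : 0 <= Ep_norm x.
Proof. exact: addr_ge0. Qed.

Lemma Ep_normD x y : Ep_norm (x + y) <= Ep_norm x + Ep_norm y.
Proof. by rewrite /Ep_norm addrACA lerD ?ler_normD. Qed.

Lemma Ep_norm_sum n (F : 'I_n -> Ep_type X tau p1) :
  Ep_norm (\sum_k F k) <= \sum_k Ep_norm (F k).
Proof.
elim/big_ind2: _ => [|x a y b xa yb|//]; first by rewrite /Ep_norm !normr0 addr0.
by rewrite (le_trans (Ep_normD _ _)) ?lerD.
Qed.

(** Valid also outside the carrier, since [fine] sends an infinite integral to 0. It supplies the
    nonnegativity that [opnorm_le_bound] asks for. *)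
Lemma Ytheta_norm_ge0 theta x : 0 <= nsnorm (Ytheta X tau p1 theta) x.
Proof.
by apply/fine_ge0/interp1_norm_ge0 => y; rewrite /= !addr_ge0.
Qed.

End delay_space.

Theorem theorem6p4 (R : realType) (X : completeNormedModType R)
    (tau p : R) (tau_lt0 : tau < 0) (p_gt1 : 1 < p)
    (T theta h0 : R) (T_gt0 : 0 < T) (theta_gt0 : 0 < theta)
    (theta_lt1 : theta < 1) (h0_gt0 : 0 < h0)
    (D : R -> Ep_type X tau p_gt1 -> Ep_type X tau p_gt1)
    (D_linear : forall t : R, 0 <= t <= T ->
      linear_on (carrier (domC X tau p_gt1)) (D t))
    (steps_ok : forall h t : R, 0 < h <= h0 -> 0 <= t <= T ->
      frozen_steps_well_defined D h t)
    (q K M_T M_Ttheta : R) (q_lt1 : q < 1) (K_gt0 : 0 < K)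
    (M_T_gt0 : 0 < M_T) (M_Ttheta_gt0 : 0 < M_Ttheta)
    (B1 : forall h t : R, 0 < h <= h0 -> 0 <= t <= T ->
      (opnorm (Ep X tau p_gt1) (Ep X tau p_gt1) (Hstep D h t) <= q%:E)%E)
    (B2 : forall h t : R, 0 < h <= h0 -> 0 <= t <= T ->
      (opnorm (Ytheta X tau p_gt1 theta) (Ep X tau p_gt1) (Estep D h t)
        <= (K * h `^ (1 + theta))%:E)%E)
    (B3 : forall h : R, 0 < h <= h0 -> forall k j : nat, (k <= j)%N ->
      j%:R * h <= T ->
      (opnorm (Ep X tau p_gt1) (Ep X tau p_gt1) (Rprod D h k j.+1)
        <= M_T%:E)%E)
    (B4 : forall h : R, 0 < h <= h0 -> forall k : nat, k%:R * h <= T ->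
      (opnorm (Ytheta X tau p_gt1 theta) (Ytheta X tau p_gt1 theta)
        (Pprod D h 0 k) <= M_Ttheta%:E)%E) :
  exists K_Ttheta : R, 0 < K_Ttheta /\
    forall h : R, 0 < h <= h0 -> forall n : nat, n%:R * h <= T ->
      (opnorm (Ytheta X tau p_gt1 theta) (Ep X tau p_gt1)
        (Rprod D h 0 n \- Pprod D h 0 n)%R
        <= (K_Ttheta * h `^ theta)%:E)%E.
Proof.
(* The 1 in 1 + M_T accounts for the empty product k = n - 1, outside (B3). *)
exists ((1 + M_T) * K * M_Ttheta * T).
have MT1 : 0 < 1 + M_T by rewrite addr_gt0.
split; first by rewrite !mulr_gt0.
move=> h h_bnd n nT; have /andP[h_gt0 _] := h_bnd.
have tk k : (k <= n)%N -> 0 <= k%:R * h <= T.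
  move=> kn; rewrite mulr_ge0 ?(ltW h_gt0)//= (le_trans _ nT)//.
  by rewrite ler_pM2r// ler_nat.
apply: opnorm_le; first by rewrite !mulr_ge0 ?powR_ge0 ?ltW.
move=> x Yx; split => //.
set Y := Ytheta X tau p_gt1 theta; have x0 := Ytheta_norm_ge0 theta x.
have R_lin k : (k < n)%N -> linear_on setT (Rstep D h (k%:R * h)).
  by move=> kn; have [_ []] := steps_ok _ _ h_bnd (tk k (ltnW kn)).
have telescope := ordered_prod_telescope
  (fun k => Pstep D h (k%:R * h)) x R_lin.
rewrite [leLHS](congr1 (@Ep_norm _ _ _ _ _) telescope).
apply: le_trans (Ep_norm_sum _) _.
(* A bound for every summand, uniform in [k]: from right to left its factors come from (B4), (B2)
   and (B3). *)
pose c := (1 + M_T) * (K * h `^ (1 + theta) * (M_Ttheta * nsnorm Y x)).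
have le_c (k : 'I_n) : Ep_norm (Rprod D h k.+1 n
    (Estep D h (k%:R * h) (Pprod D h 0 k x))) <= c.
  have tkT := tk k (ltnW (ltn_ord k)); have /andP[_ kT] := tkT.
  have [Px nPx] := opnorm_le_bound (B4 _ h_bnd _ kT) Yx x0.
  have [_ nE] := opnorm_le_bound (B2 _ _ h_bnd tkT) Px (Ytheta_norm_ge0 _ _).
  have nE_le := le_trans nE (ler_wpM2l
    (mulr_ge0 (ltW K_gt0) (powR_ge0 h (1 + theta))) nPx).
  set y := Estep _ _ _ _ in nE nE_le *.
  apply: le_trans (_ : (1 + M_T) * Ep_norm y <= _); last by rewrite ler_pM2l.
  have [kn|nk] := ltnP k.+1 n; last first.
    have kn : k.+1 = n by apply/eqP; rewrite eqn_leq nk ltn_ord.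
    rewrite kn /Rprod ordered_prodnn ler_peMl ?Ep_norm_ge0//.
    by rewrite lerDl ltW.
  (* The products in (B3) include their last index [j], so it is applied with [j = n - 1]. *)
  have n1 : n.-1.+1 = n by rewrite prednK// (leq_trans _ kn).
  have kn1 : (k.+1 <= n.-1)%N by rewrite -ltnS n1.
  have /andP[_ n1T] := tk _ (leq_pred n).
  have := B3 _ h_bnd _ _ kn1 n1T; rewrite n1 => RM.
  have [_ /le_trans->//] := opnorm_le_bound (x := y) RM I (Ep_norm_ge0 _).
  by rewrite ler_wpM2r ?Ep_norm_ge0// lerDr.
apply: le_trans (ler_sum _ (fun k _ => le_c k)) _.
(* Splitting [h ^ (1 + theta)] as [h * h ^ theta] lets one factor [h] absorb the number of summands
   through [n h <= T]. *)
rewrite sumr_const card_ord -mulr_natl /c powRD ?(gt_eqF h_gt0) ?implybT//.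
rewrite powRr1 ?(ltW h_gt0)//.
set a := h `^ theta; set b := nsnorm Y x.
have -> : n%:R * ((1 + M_T) * (K * (h * a) * (M_Ttheta * b))) =
    n%:R * h * ((1 + M_T) * K * M_Ttheta * a * b) by ring.
have -> : (1 + M_T) * K * M_Ttheta * T * a * b =
    T * ((1 + M_T) * K * M_Ttheta * a * b) by ring.
by rewrite ler_wpM2r// !mulr_ge0 ?powR_ge0 ?(ltW MT1) ?(ltW K_gt0)
  ?(ltW M_Ttheta_gt0).
Qed.
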